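(* Let $S$ be a non-empty set and let $(X,E)$ be a connected and locally finite symmetric digraph. Let $*,*'\in S$ be any two states. Then there is an $\mathbb{R}$-linear isomorphism $$C_{\mathrm{unif}}(S^X_* )\cong C_{\mathrm{unif}}(S^X_{*'})$$ which gives the map $f\mapsto f+(f(\star)-f(\star'))$ on the subspace of local functions $C_{\mathrm{loc}}(S^X)$.
   Context: A symmetric digraph $(X,E)$ is a set $X$ of vertices with a set $E\subset X\times X$ of edges such that $(x,y)\in E$ iff $(y,x)\in E$. It is locally finite if $\{(x,y)\in E\mid y\in X\}$ is finite for every $x\in X$, and connected if any two vertices are joined by a finite path. $d_X$ is the graph distance, and $\operatorname{diam}(\Lambda):=\sup_{x,y\in\Lambda}d_X(x,y)$ for $\Lambda\subset X$ (with $\operatorname{diam}(\emptyset)=0$). $S^X:=\prod_{x\in X}S$ is the configuration space. For $\Lambda\subset X$, $C(S^\Lambda)$ is the space of real functions on $S^\Lambda$, viewed as functions on $S^X$ (and on $S^X_*$ below) depending only on the components in $\Lambda$. $\mathscr{I}$ is the set of finite subsets of $X$ (including $\emptyset$). The space of local functions is $C_{\mathrm{loc}}(S^X):=\bigcup_{\Lambda\in\mathscr{I}}C(S^\Lambda)$. For a base state $*\in S$, $S^X_*\subset S^X$ is the set of $\eta$ with $\eta_x=*$ for all but finitely many $x$; $\star$ (resp. $\star'$) is the configuration with all components $*$ (resp. $*'$); $C(S^X_* )$ is the space of all functions $S^X_*\to\mathbb{R}$. For $f\in C(S^X_* )$ and $\Lambda\subset X$, $\iota^\Lambda_*f(\eta):=f(\eta|_\Lambda)$,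 where $\eta|_\Lambda$ agrees with $\eta$ on $\Lambda$ and equals $*$ outside $\Lambda$. For $\Lambda\in\mathscr{I}$, $C_\Lambda(S^X_* )$ is the space of $f\in C(S^\Lambda)$ such that $\iota^{\Lambda'}_*f=0$ for every finite $\Lambda'\subset X$ with $\Lambda\not\subset\Lambda'$. Every $f\in C(S^X_* )$ has a unique expansion $f=\sum_{\Lambda\in\mathscr{I}}f^*_\Lambda$ with $f^*_\Lambda\in C_\Lambda(S^X_* )$ (a finite sum at each point of $S^X_*$). $f$ is uniform if there is $R>0$ with $f^*_\Lambda=0$ whenever $\operatorname{diam}(\Lambda)>R$; $C_{\mathrm{unif}}(S^X_* )$ is the space of uniform functions. Local functions are regarded as elements of $C_{\mathrm{unif}}(S^X_* )$ (and of $C_{\mathrm{unif}}(S^X_{*'})$) by restriction to $S^X_*$ (resp. $S^X_{*'}$). *)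

(* Defs.v *)
From HB Require Import structures.
From mathcomp Require Import all_boot all_order all_algebra finmap.
From mathcomp Require Import all_classical all_reals.
From mathcomp Require Import ereal.

Set Implicit Arguments.
Unset Strict Implicit.
Unset Printing Implicit Defensive.
Import Order.TTheory GRing.Theory Num.Theory.
Local Open Scope classical_set_scope.
Local Open Scope ring_scope.

Section Digraph.
Variables (X : Type) (E : set (X * X)).

Definition symmetric_digraph := forall x y, E (x, y) <-> E (y, x).

Definition locally_finite :=
  forall x, finite_set [set e | E e /\ e.1 = x].

Definition edge : rel X := fun x y => (x, y) \in E.

(* As in path.v, the path x :: p is given by its source x and its tail p, so
   that its length (number of edges) is size p. *)
Definition joins x y (p : seq X) := path edge x p /\ last x p = y.

Definition connected_digraph := forall x y, exists p, joins x y p.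

Variable R : realType.

(* The distance is +oo between vertices that no path joins. *)
Definition graph_dist x y : \bar R :=
  ereal_inf [set ((size p)%:R)%:E | p in joins x y].

(* ereal_sup set0 = -oo; adjoining 0 gives diam set0 = 0 and changes nothing
   otherwise, since graph_dist is nonnegative. *)
Definition diam (A : set X) : \bar R :=
  ereal_sup (0%E |` [set d | exists2 x, A x & exists2 y, A y & d = graph_dist x y]).

End Digraph.

Section Configurations.
Variables (R : realType) (S : Type) (X : choiceType).

Definition local_fun (f : (X -> S) -> R) :=
  exists L : {fset X}, forall eta eta' : X -> S,
    {in L, eta =1 eta'} -> f eta = f eta'.

Section BaseState.
Variable s : S.

Definition fin_config : set (X -> S) :=
  [set eta | finite_set [set x | eta x <> s]].

Fact restrict_subproof (A : set X) (eta : fin_config) :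
  patch (fun=> s) A (\val eta) \in fin_config.
Proof.
apply/mem_set; apply: sub_finite_set (set_valP eta) => x /=.
by rewrite /patch; case: ifP.
Qed.

Definition restrict_config (A : set X) (eta : fin_config) : fin_config :=
  SigSub (restrict_subproof A eta).

(* The codomain R^o is R as a module over itself, which makes
   fin_config -> R^o an lmodType R. *)
Definition iota_proj (A : set X) (f : fin_config -> R^o) : fin_config -> R^o :=
  f \o restrict_config A.

(* C(S^L), seen inside C(S^X_* ) *)
Definition depends_on (L : {fset X}) (f : fin_config -> R^o) :=
  forall eta eta' : fin_config,
    {in L, \val eta =1 \val eta'} -> f eta = f eta'.

(* C_L(S^X_* ) *)
Definition exact_support (L : {fset X}) (f : fin_config -> R^o) :=
  depends_on L f /\
  forall L' : {fset X}, ~~ (L `<=` L')%fset -> iota_proj [set` L'] f = 0.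

(* Each f has exactly one expansion g: g L is the component f^*_L. *)
Definition expansion (f : fin_config -> R^o)
    (g : {fset X} -> fin_config -> R^o) :=
  (forall L, exact_support L (g L)) /\
  forall eta, finite_set [set L | g L eta <> 0] /\
              f eta = \sum_(L \in [set: {fset X}]) g L eta.

Definition uniform (E : set (X * X)) (f : fin_config -> R^o) :=
  exists2 g, expansion f g &
  exists2 r : R, 0 < r &
    forall L : {fset X}, (r%:E < diam E R [set` L])%E -> g L = 0.

Lemma expansion_linear (a : R) f1 f2 g1 g2 :
  expansion f1 g1 -> expansion f2 g2 ->
  expansion (a *: f1 + f2) (fun L => a *: g1 L + g2 L).
Proof.
move=> [supp1 sum1] [supp2 sum2].
have linE (h1 h2 : fin_config -> R^o) eta :
  (a *: h1 + h2) eta = a * h1 eta + h2 eta by [].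
split=> [L|eta].
  have [dep1 van1] := supp1 L; have [dep2 van2] := supp2 L; split.
    by move=> eta eta' eqL; rewrite !linE (dep1 _ _ eqL) (dep2 _ _ eqL).
  move=> L' nLL'; apply/funext => eta.
  have e1 : g1 L (restrict_config [set` L'] eta) = 0.
    exact: (congr1 (fun h => h eta) (van1 _ nLL')).
  have e2 : g2 L (restrict_config [set` L'] eta) = 0.
    exact: (congr1 (fun h => h eta) (van2 _ nLL')).
  by rewrite /iota_proj /= linE e1 e2 mulr0 addr0.
have [fin1 e1] := sum1 eta; have [fin2 e2] := sum2 eta.
set A1 := [set L | g1 L eta <> 0] in fin1.
set A2 := [set L | g2 L eta <> 0] in fin2.
have A12 L : ~ (A1 `|` A2) L -> g1 L eta = 0 /\ g2 L eta = 0.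
  by move=> /not_orP[/contrapT ? /contrapT ?].
have finA : finite_set (A1 `|` A2) by rewrite finite_setU.
have wid (F : {fset X} -> R) : (forall L, ~ (A1 `|` A2) L -> F L = 0) ->
    \sum_(L \in [set: {fset X}]) F L = \sum_(L \in A1 `|` A2) F L.
  by move=> F0; apply/esym/fsbig_widen => // L [_ /F0].
have lin0 L : ~ (A1 `|` A2) L -> (a *: g1 L + g2 L) eta = 0.
  by move=> /A12[z1 z2]; rewrite linE z1 z2 mulr0 addr0.
split.
  by apply: sub_finite_set finA => L /=; apply: contra_notP => /lin0.
rewrite linE e1 e2 (wid (fun L => g1 L eta)) => [|L /A12[]//].
rewrite (wid (fun L => g2 L eta)) => [|L /A12[]//].
rewrite (wid (fun L => (a *: g1 L + g2 L) eta) lin0) mulr_fsumr.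
by rewrite -fsbig_split.
Qed.

Section UniformFunctions.
Variable E : set (X * X).

Definition uniform_pred : {pred (fin_config -> R^o)} :=
  fun f => `[< uniform E f >].

Lemma uniform_submod_closed : submod_closed uniform_pred.
Proof.
split=> [|a f1 f2 /asboolP f1u /asboolP f2u]; apply/asboolP.
  exists (fun=> 0); last by exists 1.
  split=> [L|eta]; first by split.
  by rewrite fsbig1 //; split=> //; apply: sub_finite_set (finite_set0 _) => L /=.
have [g1 ex1 [r1 r1_gt0 h1]] := f1u; have [g2 ex2 [r2 r2_gt0 h2]] := f2u.
exists (fun L => a *: g1 L + g2 L); first exact: expansion_linear.
exists (r1 + r2) => [|L ltL]; first exact: addr_gt0.
rewrite h1 ?h2 ?scaler0 ?addr0 //; apply: le_lt_trans ltL.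
  by rewrite lee_fin lerDr ltW.
by rewrite lee_fin lerDl ltW.
Qed.

HB.instance Definition _ := GRing.isSubmodClosed.Build R (fin_config -> R^o)
  uniform_pred uniform_submod_closed.

Record unif_fun :=
  UnifFun { unif_val : fin_config -> R^o ; _ : unif_val \in uniform_pred }.

HB.instance Definition _ := [isSub for unif_val].
HB.instance Definition _ := [Choice of unif_fun by <:].
HB.instance Definition _ := [SubChoice_isSubLmodule of unif_fun by <:].

End UniformFunctions.

Definition to_fin_config (f : (X -> S) -> R) : fin_config -> R^o :=
  fun eta => f (\val eta).

End BaseState.
End Configurations.

Arguments unif_fun R {S X} s E.
Arguments to_fin_config {R S X} s f.

(* Main.v *)
From HB Require Import structures.
Require Import Defs.
From mathcomp Require Import all_boot all_order all_algebra finmap.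
From mathcomp Require Import all_classical all_reals.
From mathcomp Require Import ereal.

Set Implicit Arguments.
Unset Strict Implicit.
Unset Printing Implicit Defensive.
Import Order.TTheory GRing.Theory Num.Theory.
Local Open Scope classical_set_scope.
Local Open Scope ring_scope.

(** Write [f = \sum_L f_L] for the expansion of a uniform [f] at the base state
[s]. For a local [f] the target [f + f(base s) - f(base s')] equals
[f(base s) + \sum_L (f_L - f_L(base s'))], and this series makes sense for every
uniform [f] and every configuration [a] of base [s']: its terms vanish unless [L]
meets the finite support of [a], and only finitely many [L] of bounded diameter
do, because balls are finite. Summing over the [L] inside a large finite [B]
turns the series into
    [f(base s) + (f(a clipped to B) - f(base s' clipped to B))],
where clipping to [B] puts [s] outside [B]; this value does not depend on [B]
once [B] is large. The relation [transports] says that [h(a)] is this eventual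
value, and so defines the isomorphism without mentioning expansions.

What makes this work is a description of uniformity in which the base state does
not enter: [f] is uniform iff it is [decoupled] at some range [r], that is, two
perturbations of a configuration at distance more than [r] from each other change
[f] by independent amounts.
- A uniform function is decoupled since each term of its expansion lives on a set
  of diameter at most [r], which cannot meet both perturbations
  ([uniform_decoupled]).
- Conversely Moebius inversion over finite subsets expands any function, and if
  [L] contains two points at distance more than [r], then [f_L] is an alternating
  sum of mixed second differences at these points, hence vanishes
  ([decoupled_uniform]).

Decoupling gives all the rest. It makes the clipped differences eventually
constant ([decoupled_transports]), it passes to the transported function because
clipping is pointwise ([transports_decoupled]), and it shows that transport from
[s'] back to [s] is the inverse of transport from [s] to [s'] ([transports_sym]).
Connectedness is what makes the diameter of a finite set finite, so that local
functions are uniform. *)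

(** * Finite balls and finite diameters *)

Section FiniteBalls.
Variables (X : choiceType) (E : set (X * X)).

Lemma finite_walk_ends (x : X) (n : nat) : locally_finite E ->
  finite_set [set y | exists2 p, joins E x y p & size p = n].
Proof.
move=> lfE; elim: n x => [|n IHn] x.
  apply: sub_finite_set (finite_set1 x) => y /= [p [_ <-] /size0nil ->] //.
have finN : finite_set [set z | E (x, z)].
  apply: sub_finite_set (finite_image snd (lfE x)) => z /= Exz.
  by exists (x, z).
apply: sub_finite_set (bigcup_finite finN (fun z _ => IHn z)) => y /=.
move=> [[|z p] [//= /andP[exz zp] lastp] [sz]].
by exists z; [exact/set_mem | exists p].
Qed.

Lemma graph_dist_refl (R : realType) (x : X) : (graph_dist E R x x <= 0)%E.
Proof. by apply: ereal_inf_lbound; exists [::]. Qed.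

Lemma finite_ball (R : realType) (r : R) (x : X) : locally_finite E ->
  finite_set [set y | (graph_dist E R x y <= r%:E)%E].
Proof.
move=> lfE; pose N := (Num.truncn r).+1.
pose D := \bigcup_(n in `I_N)
  [set y | exists2 p, joins E x y p & size p = n].
have finD : finite_set D.
  by apply: bigcup_finite => // n _; exact: finite_walk_ends.
apply: sub_finite_set finD => y /= dxy.
have /ereal_inf_lt[_ [p xyp <-]] : (graph_dist E R x y < N%:R%:E)%E.
  by apply: le_lt_trans dxy _; rewrite lte_fin truncnS_gt.
by rewrite lte_fin ltr_nat => ltp; exists (size p) => //; exists p.
Qed.

(** The form in which local finiteness is used: leaving a suitable finite [B] means
being far from the whole of the finite set [A]. *)
Lemma finite_neighbourhood (R : realType) (r : R) (A : set X) :
  locally_finite E -> finite_set A ->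
  exists B : {fset X}, forall x y, A x ->
    y \in B \/ (r%:E < graph_dist E R x y)%E.
Proof.
move=> lfE finA.
have finB : finite_set (\bigcup_(x in A)
    [set y | (graph_dist E R x y <= r%:E)%E]).
  by apply: bigcup_finite => // x _; exact: finite_ball.
exists (fset_set (\bigcup_(x in A) [set y | (graph_dist E R x y <= r%:E)%E])).
move=> x y Ax; have [dxy|] := leP (graph_dist E R x y) r%:E; last by right.
by left; rewrite in_fset_set //; apply/mem_set; exists x.
Qed.

Lemma finite_diameter (R : realType) (L : {fset X}) : connected_digraph E ->
  exists2 r : R, 0 < r &
    forall x y, x \in L -> y \in L -> (graph_dist E R x y <= r%:E)%E.
Proof.
move=> connE; have [p pP] := choice (fun u : X * X => connE u.1 u.2).
pose F x y : nat := size (p (x, y)).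
(* The lengths of chosen paths between all pairs of points of L are bounded by
   their sum; the successor makes the bound positive. *)
exists (\sum_(x <- L) \sum_(y <- L) F x y).+1%:R => // x y xL yL.
apply: le_trans (_ : ((F x y)%:R%:E <= _)%E).
  by apply: ereal_inf_lbound; exists (p (x, y)) => //; exact: (pP (x, y)).
rewrite lee_fin ler_nat.
rewrite (big_fsetD1 x) //= (big_fsetD1 y) //=.
by rewrite -addnA -addnS leq_addr.
Qed.

End FiniteBalls.

(** * Moebius inversion over finite subsets *)

Section Moebius.
Variables (K : choiceType) (R : pzRingType).
Implicit Types (A B M : {fset K}) (F G : {fset K} -> R).

Lemma big_fpowersetU1 (x : K) A F : x \notin A ->
  \sum_(M <- fpowerset (x |` A)%fset) F M =
  \sum_(M <- fpowerset A) (F M + F (x |` M)%fset).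
Proof.
move=> xA; rewrite big_split /= (big_fsetID _ (fun M => x \notin M)) /=.
congr (_ + _).
  congr bigop; congr enum_fset; apply/fsetP => M; rewrite !inE /= !fpowersetE.
  apply/andP/idP => [[/fsubsetP MA xM]|/fsubsetP MA]; last first.
    split; last by apply: contra xA => /MA.
    by apply/fsubsetP => y /MA yA; rewrite !inE yA orbT.
  apply/fsubsetP => y yM; have := MA _ yM; rewrite !inE => /orP[/eqP yx|//].
  by move: xM; rewrite -yx yM.
have <- : \sum_(N <- [fset (x |` M)%fset | M in fpowerset A]%fset) F N =
    \sum_(M <- fpowerset A) F (x |` M)%fset.
  rewrite big_imfset // => M N; rewrite !fpowersetE => /fsubsetP MA /fsubsetP NA.
  have nx (Q : {fset K}) : {subset Q <= A} -> x \notin Q by move=> QA; apply: contra xA => /QA.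
  by move=> eqMN; rewrite -(fsetU1K (nx _ MA)) eqMN fsetU1K // nx.
congr bigop; congr enum_fset; apply/fsetP => M.
rewrite !inE /= negbK fpowersetE; apply/andP/imfsetP => [[MA xM]|[N /= NA ->]].
  exists (M `\ x)%fset; last by rewrite fsetD1K.
  by rewrite /= fpowersetE fsubDset.
by rewrite fset1U1 fsetUS // -fpowersetE.
Qed.

(** The sign is [(-1) ^ #|A \ M|]: adding the two cardinals has the same parity as
subtracting them. *)
Definition moebius F A : R :=
  \sum_(M <- fpowerset A) (-1) ^+ (#|` A| + #|` M|) * F M.

Lemma eq_moebius F G A :
  (forall M, (M `<=` A)%fset -> F M = G M) -> moebius F A = moebius G A.
Proof.
move=> eqFG; rewrite /moebius big_seq [RHS]big_seq; apply: eq_bigr => M.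
by rewrite fpowersetE => /eqFG ->.
Qed.

Lemma moebius0 A : moebius (fun=> 0) A = 0.
Proof. by rewrite /moebius big1 // => M _; rewrite mulr0. Qed.

Lemma moebiusD F G A :
  moebius (fun M => F M + G M) A = moebius F A + moebius G A.
Proof.
by rewrite -big_split /=; apply: eq_bigr => M _; rewrite mulrDr.
Qed.

(** Pairing [M] with [x |` M] exhibits the transform as an iterated difference
operator; every later fact on [moebius] is obtained by peeling off points this
way. *)
Lemma moebiusU1 x A F : x \notin A ->
  moebius F (x |` A)%fset = moebius (fun M => F (x |` M)%fset - F M) A.
Proof.
move=> xA; rewrite /moebius big_fpowersetU1 // big_seq [RHS]big_seq.
apply: eq_bigr => M; rewrite fpowersetE => /fsubsetP MA.
have xM : x \notin M by apply: contra xA => /MA.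
rewrite !cardfsU1 xA xM /= !add1n addSn addSn addnS !exprS !mulN1r opprK.
by rewrite mulrBr mulNr addrC.
Qed.

(** Splitting off [x], the subsets with and without [x] contribute
[F (x |` M) - F M] and [F M], so the sum telescopes to the one for
[F (x |` _)] over the remaining points. *)
Lemma sum_moebius A F : \sum_(M <- fpowerset A) moebius F M = F A.
Proof.
move: {2}#|` A| (erefl #|` A|) => n; elim: n A F => [|n IHn] A F.
  move=> /cardfs0_eq ->; rewrite fpowerset0 big_seq_fset1 /moebius.
  by rewrite fpowerset0 big_seq_fset1 cardfs0 mul1r.
move=> cA; have /fset0Pn[x xA] : A != fset0 by rewrite -cardfs_eq0 cA.
have xD : x \notin (A `\ x)%fset by rewrite !inE eqxx.
have {cA} cD : #|` (A `\ x)%fset| = n by move: cA; rewrite (cardfsD1 x) xA => -[].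
rewrite -{1}(fsetD1K xA) big_fpowersetU1 //.
rewrite -[RHS](congr1 F (fsetD1K xA)) -(IHn _ (fun M => F (x |` M)%fset) cD).
rewrite big_seq [RHS]big_seq; apply: eq_bigr => M.
rewrite fpowersetE => /fsubsetP MD; rewrite moebiusU1; last first.
  by apply: contra xD => /MD.
by rewrite -moebiusD; apply: eq_moebius => N _; rewrite addrC subrK.
Qed.

Lemma moebius_stable x A F : x \in A ->
  (forall M, F (x |` M)%fset = F M) -> moebius F A = 0.
Proof.
move=> xA stabF; rewrite -(fsetD1K xA) moebiusU1 ?inE ?eqxx //.
by rewrite -[RHS](moebius0 (A `\ x)%fset); apply: eq_moebius => M _; rewrite stabF subrr.
Qed.

(** Peeling off two points leaves the mixed second difference of [F] at [x] and
[y], which the hypothesis makes zero. *)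
Lemma moebius_additive x y A F : x \in A -> y \in A -> x != y ->
  (forall M, x \notin M -> y \notin M ->
    F (x |` (y |` M))%fset - F (y |` M)%fset = F (x |` M)%fset - F M) ->
  moebius F A = 0.
Proof.
move=> xA yA xy addF.
have yD : y \in (A `\ x)%fset by rewrite !inE eq_sym xy.
rewrite -(fsetD1K xA) moebiusU1 ?inE ?eqxx // -(fsetD1K yD) moebiusU1 ?inE ?eqxx //.
rewrite -[RHS](moebius0 ((A `\ x) `\ y)%fset); apply: eq_moebius => M /fsubsetP MA.
by rewrite addF ?subrr //; apply/negP => /MA; rewrite !inE eqxx ?andbF.
Qed.

End Moebius.

(** * Clipping configurations to finite sets *)

Section Configurations.
Variables (S : Type) (X : choiceType).
Implicit Types (s : S) (B M : {fset X}) (eta : X -> S).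

Lemma fin_config_ext s (a b : @fin_config S X s) :
  (forall x, \val a x = \val b x :> S) -> a = b.
Proof. by move=> eqab; apply/val_inj/funext. Qed.

Fact clip_subproof s B eta : (fun x => if x \in B then eta x else s) \in @fin_config S X s.
Proof.
apply/mem_set; apply: sub_finite_set (finite_fset B) => x /=.
by case: ifP.
Qed.

(** Unlike [restrict_config], clipping accepts a configuration of any base, and it
is how configurations move from one base state to another. *)
Definition clip s B eta : @fin_config S X s := SigSub (clip_subproof s B eta).

Lemma clipE s B eta x : \val (clip s B eta) x = if x \in B then eta x else s.
Proof. by []. Qed.

Lemma clip_eq s B eta eta' : {in B, eta =1 eta'} -> clip s B eta = clip s B eta'.
Proof.
by move=> eqB; apply: fin_config_ext => x; rewrite !clipE; case: ifP => // /eqB.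
Qed.

(** The configuration constantly equal to [s]; clipping to the empty set supplies
the proof of finite support. *)
Definition base s : @fin_config S X s := clip s fset0 (cst s).

Lemma baseE s x : \val (base s) x = s.
Proof. by rewrite clipE inE. Qed.

Lemma restrict_configE s (A : set X) (a : @fin_config S X s) x :
  \val (restrict_config A a) x = if x \in A then \val a x else s.
Proof. by []. Qed.

Lemma restrict_config_fset s B (a : @fin_config S X s) :
  restrict_config [set` B] a = clip s B (\val a).
Proof. by apply: fin_config_ext => x; rewrite restrict_configE clipE mem_setE. Qed.

Lemma clip_support s (a : @fin_config S X s) B :
  (forall x, \val a x <> s -> x \in B) -> clip s B (\val a) = a.
Proof.
move=> supB; apply: fin_config_ext => x; rewrite clipE; case: ifP => // /negbT xB.
by apply/esym; apply: contrapT => /supB; apply/negP.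
Qed.

End Configurations.

(** * Uniformity without a base state *)

Section Decoupling.
Variables (R : realType) (S : Type) (X : choiceType) (E : set (X * X)).
Implicit Types (s : S) (r : R).

(** View [a, b] on one hand and [a', b'] on the other as the same perturbation done
against two backgrounds. The first disjunct fails at the points [x] that the
perturbation moves, the second at the points [y] where the backgrounds differ;
such [x] and [y] have to be far from each other. *)
Definition far_apart r (a b a' b' : X -> S) := forall x y,
  [\/ a x = b x /\ a' x = b' x, a y = a' y /\ b y = b' y
    | (r%:E < graph_dist E R x y)%E].

Definition decoupled s r (f : @fin_config S X s -> R^o) :=
  forall a b a' b' : fin_config s,
    far_apart r (\val a) (\val b) (\val a') (\val b') ->
    f a - f b = f a' - f b'.

(** A set [L] of small diameter cannot see both the perturbation and the change of
background. *)
Lemma far_apart_dichotomy r (a b a' b' : X -> S) (L : {fset X}) :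
  far_apart r a b a' b' ->
  (forall x y, x \in L -> y \in L -> (graph_dist E R x y <= r%:E)%E) ->
  ({in L, a =1 b} /\ {in L, a' =1 b'}) \/ ({in L, a =1 a'} /\ {in L, b =1 b'}).
Proof.
move=> far near.
have [[y yL ny]|noy] :=
  pselect (exists2 y, y \in L & ~ (a y = a' y /\ b y = b' y)); last first.
  right; split=> y yL; apply: contrapT => ne; apply: noy; exists y => //;
    by case=> *; exact: ne.
have eqx x : x \in L -> a x = b x /\ a' x = b' x.
  move=> xL; case: (far x y) => // far_xy.
  by have := lt_le_trans far_xy (near _ _ xL yL); rewrite ltxx.
by left; split=> x /eqx[].
Qed.

Lemma depends_on_far_apart s r (L : {fset X}) (g : @fin_config S X s -> R^o)
    (a b a' b' : @fin_config S X s) : depends_on L g ->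
  far_apart r (\val a) (\val b) (\val a') (\val b') ->
  (forall x y, x \in L -> y \in L -> (graph_dist E R x y <= r%:E)%E) ->
  g a - g b = g a' - g b'.
Proof.
move=> dep far near; case: (far_apart_dichotomy far near) => -[e1 e2].
  by rewrite (dep _ _ e1) (dep _ _ e2) !subrr.
by rewrite (dep _ _ e1) (dep _ _ e2).
Qed.

(** The four expansions are summed over a common finite set of indices, on which
the claim is checked term by term. *)
Lemma uniform_decoupled s (f : @fin_config S X s -> R^o) :
  uniform E f -> exists2 r, 0 < r & decoupled r f.
Proof.
move=> [g [supp_g sum_g] [r r_gt0 g0]]; exists r => // a b a' b' far.
have [fa ->] := sum_g a; have [fb ->] := sum_g b.
have [fa' ->] := sum_g a'; have [fb' ->] := sum_g b'.
pose D := fset_set [set L | (g L a <> 0 \/ g L b <> 0) \/ (g L a' <> 0 \/ g L b' <> 0)].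
have widD (c : @fin_config S X s) :
    (forall L, g L c <> 0 -> (g L a <> 0 \/ g L b <> 0) \/ (g L a' <> 0 \/ g L b' <> 0)) ->
    \sum_(L \in [set: {fset X}]) g L c = \sum_(L <- D) g L c.
  move=> subc; rewrite -fsbig_finite //; last first.
    apply: (@sub_finite_set _ _ (([set L | g L a <> 0] `|` [set L | g L b <> 0]) `|`
      ([set L | g L a' <> 0] `|` [set L | g L b' <> 0]))); last by rewrite !finite_setU.
    by [].
  apply/esym/fsbig_widen => // L [_ /= nL]; apply: contrapT => /subc; exact: nL.
rewrite (widD a) ?(widD b) ?(widD a') ?(widD b') -?sumrB; try by move=> L; tauto.
apply: eq_bigr => L _; have [diamL|/g0 gL0] := leP (diam E R [set` L]) r%:E.
  apply: (depends_on_far_apart (supp_g L).1 far) => x y xL yL.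
  apply: le_trans diamL; apply: ereal_sup_ubound; right.
  by exists x => //; exists y.
by rewrite gL0.
Qed.

(** The component [f^*_L] of the expansion at [s], given by inclusion-exclusion. *)
Definition component s (f : @fin_config S X s -> R^o) (L : {fset X}) : fin_config s -> R^o :=
  fun a => moebius (fun M => f (clip s M (\val a)) : R) L.

(** Once a point [x] of [L] has been reset to [s], the clipped configurations do not
see whether [x] belongs to [M], and the alternating sum cancels. *)
Lemma component_exact_support s (f : @fin_config S X s -> R^o) L :
  exact_support L (component f L).
Proof.
split=> [a b eqab|L' /fsubsetPn[x xL xL']].
  apply: eq_moebius => M /fsubsetP ML; congr f.
  by apply: clip_eq => x /ML; exact: eqab.
apply/funext => a; apply: moebius_stable xL _ => M; congr f.
apply: fin_config_ext => y; rewrite !clipE !restrict_configE mem_setE !inE.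
by have [->|//] := eqVneq y x; rewrite (negbTE xL') /=; case: ifP.
Qed.

Lemma expansion_component s (f : @fin_config S X s -> R^o) : expansion f (component f).
Proof.
split=> [L|a]; first exact: component_exact_support.
pose A := fset_set [set x | \val a x <> s].
have supA x : \val a x <> s -> x \in A.
  by move=> ax; rewrite in_fset_set; [exact/mem_set | exact: set_valP a].
have outA L : component f L a <> 0 -> L \in fpowerset A.
  rewrite fpowersetE => nz; apply/negPn/negP => LA; apply: nz.
  have /(congr1 (fun h => h a)) := (component_exact_support f L).2 _ LA.
  by rewrite /iota_proj /= restrict_config_fset clip_support.
split; first exact: sub_finite_set outA (finite_fset (fpowerset A)).
rewrite -[in LHS](clip_support supA).
rewrite -(sum_moebius A (fun M => f (clip s M (\val a)) : R)) fsbig_seq //.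
by apply: fsbig_widen => // L [_ /= nL]; apply: contrapT => /outA.
Qed.

(** If [L] has diameter more than [r], it contains points [x] and [y] at distance
more than [r]. Adding [x] to the clipping set perturbs the configuration at [x]
only, adding [y] changes the background at [y] only, so the mixed second
differences vanish. *)
Lemma decoupled_uniform s r (f : @fin_config S X s -> R^o) :
  0 < r -> decoupled r f -> uniform E f.
Proof.
move=> r_gt0 dec; exists (component f); first exact: expansion_component.
exists r => // L /ereal_sup_gt[_ [->|[x xL [y yL ->]]] far_xy].
  by move: far_xy; rewrite lte_fin ltNge ltW.
have xy : x != y.
  apply: contraTneq far_xy => ->; rewrite -leNgt.
  by apply: le_trans (graph_dist_refl _ _ _) _; rewrite lee_fin ltW.
apply/funext => a; apply: (moebius_additive xL yL xy) => M xM yM.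
apply: dec => u v; rewrite !clipE !inE.
have [->|ux] := eqVneq u x; last by apply: Or31.
by have [->|vy] := eqVneq v y; [exact: Or33 | exact: Or32].
Qed.

End Decoupling.

(** * Transport between base states *)

Section Transport.
Variables (R : realType) (S : Type) (X : choiceType) (E : set (X * X)).
Implicit Types (s : S) (r : R) (B : {fset X}).

Definition transports s s' (f : @fin_config S X s -> R^o)
    (h : @fin_config S X s' -> R^o) := forall a, exists B0 : {fset X},
  forall B, (B0 `<=` B)%fset ->
    h a = f (base X s) + (f (clip s B (\val a)) - f (clip s B (cst s'))).

Lemma transports_unique s s' (f : @fin_config S X s -> R^o)
    (h1 h2 : @fin_config S X s' -> R^o) :
  transports f h1 -> transports f h2 -> h1 = h2.
Proof.
move=> fh1 fh2; apply/funext => a.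
have [B1 e1] := fh1 a; have [B2 e2] := fh2 a.
by rewrite (e1 (B1 `|` B2)%fset) ?fsubsetUl // (e2 (B1 `|` B2)%fset) ?fsubsetUr.
Qed.

Lemma transports_linear s s' (c : R) (f1 f2 : @fin_config S X s -> R^o)
    (h1 h2 : @fin_config S X s' -> R^o) :
  transports f1 h1 -> transports f2 h2 ->
  transports (c *: f1 + f2) (c *: h1 + h2).
Proof.
move=> fh1 fh2 a; have [B1 e1] := fh1 a; have [B2 e2] := fh2 a.
exists (B1 `|` B2)%fset => B; rewrite fsubUset => /andP[B1B B2B].
have linE t (h k : @fin_config S X t -> R^o) b : (c *: h + k) b = c * h b + k b by [].
by rewrite !linE (e1 _ B1B) (e2 _ B2B) !mulrDr mulrN opprD addrACA [_ - _ + _]addrACA.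
Qed.

Lemma transports_base s s' (f : @fin_config S X s -> R^o)
    (h : @fin_config S X s' -> R^o) : transports f h -> h (base X s') = f (base X s).
Proof.
move=> /(_ (base X s'))[B /(_ B (fsubset_refl B)) ->].
by rewrite (clip_eq _ (eta' := cst s')) ?subrr ?addr0 // => x _; rewrite baseE.
Qed.

Lemma transports_sub s s' (f : @fin_config S X s -> R^o)
    (h : @fin_config S X s' -> R^o) (a b : @fin_config S X s') :
  transports f h -> exists B0 : {fset X}, forall B, (B0 `<=` B)%fset ->
    h a - h b = f (clip s B (\val a)) - f (clip s B (\val b)).
Proof.
move=> fh; have [Ba ea] := fh a; have [Bb eb] := fh b.
exists (Ba `|` Bb)%fset => B; rewrite fsubUset => /andP[BaB BbB].
by rewrite (ea _ BaB) (eb _ BbB) opprD addrACA subrr add0r opprB addrA subrK.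
Qed.

(** Let [B0] contain all points near the support of [a]. Enlarging [B0] changes the
background outside [B0] only, which is far from where [a] differs from [s']. *)
Lemma decoupled_transports s s' r (f : @fin_config S X s -> R^o) :
  locally_finite E -> decoupled E r f ->
  exists h : @fin_config S X s' -> R^o, transports f h.
Proof.
move=> lfE dec.
suff /choice[h hP] : forall a : @fin_config S X s', exists v : R^o,
    exists B0 : {fset X}, forall B, (B0 `<=` B)%fset ->
    v = f (base X s) + (f (clip s B (\val a)) - f (clip s B (cst s'))) by exists h.
move=> a; have [B0 near] := finite_neighbourhood r lfE (set_valP a).
exists (f (base X s) + (f (clip s B0 (\val a)) - f (clip s B0 (cst s')))), B0.
move=> B /fsubsetP B0B; congr (_ + _); apply: dec => x y.
have [ax|/(near x y)[yB0|]] := pselect (\val a x = s').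
- by apply: Or31; rewrite !clipE ax.
- by apply: Or32; rewrite !clipE yB0 B0B.
- exact: Or33.
Qed.

Lemma transports_decoupled s s' r (f : @fin_config S X s -> R^o)
    (h : @fin_config S X s' -> R^o) :
  transports f h -> decoupled E r f -> decoupled E r h.
Proof.
move=> fh dec a b a' b' far.
have [B1 e1] := transports_sub a b fh; have [B2 e2] := transports_sub a' b' fh.
rewrite (e1 (B1 `|` B2)%fset) ?fsubsetUl // (e2 (B1 `|` B2)%fset) ?fsubsetUr //.
apply: dec => x y; rewrite !clipE; case: (far x y) => [[-> ->]|[-> ->]|].
- exact: Or31.
- exact: Or32.
- exact: Or33.
Qed.

(** For [B] containing all points near the support of [a], the double clipping
amounts to the values of [a] on [B], then [s'] on the rest of a larger set,
then [s]. Near the support of [a] it coincides with [a], and the collar of [s']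
around [B] is a change of background too far away to matter. *)
Lemma transports_sym s s' r (f : @fin_config S X s -> R^o)
    (h : @fin_config S X s' -> R^o) :
  locally_finite E -> decoupled E r f -> transports f h -> transports h f.
Proof.
move=> lfE dec fh a.
have [B0 near] := finite_neighbourhood r lfE (set_valP a).
exists B0 => B /fsubsetP B0B.
have [B1 e] := transports_sub (clip s' B (\val a)) (clip s' B (cst s)) fh.
rewrite (transports_base fh) (e (B1 `|` B)%fset) ?fsubsetUl //.
apply/eqP; rewrite addrC -subr_eq; apply/eqP; apply: dec => x y.
have [ax|/(near x y)[yB0|]] := pselect (\val a x = s).
- by apply: Or31; rewrite baseE !clipE ax.
- by apply: Or32; rewrite baseE !clipE !inE (B0B _ yB0) orbT.
- exact: Or33.
Qed.

Lemma local_decoupled s (f : (X -> S) -> R) :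
  connected_digraph E -> local_fun f ->
  exists2 r : R, 0 < r & decoupled E r (to_fin_config s f).
Proof.
move=> connE [L locf]; have [r r_gt0 near] := finite_diameter R L connE.
exists r => // a b a' b' far; apply: depends_on_far_apart far near.
by move=> c c' /locf.
Qed.

(** Once [B] contains the finite set that [f] depends on, clipping to [B] does not
change [f]. *)
Lemma local_transports s s' (f : (X -> S) -> R) : local_fun f ->
  transports (to_fin_config s f)
    (to_fin_config s' (fun eta => f eta + (f (cst s) - f (cst s')))).
Proof.
move=> [L locf] a; exists L => B /fsubsetP LB.
have eL eta : f (\val (clip s B eta)) = f eta.
  by apply: locf => x xL; rewrite clipE LB.
rewrite /to_fin_config !eL (locf (\val (base X s)) (cst s)) => [|x _]; last exact: baseE.
by rewrite addrCA.
Qed.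

End Transport.

Theorem proposition2p5 (R : realType) (S : Type) (X : choiceType)
    (E : set (X * X)) (symE : symmetric_digraph E)
    (connE : connected_digraph E) (lfE : locally_finite E) (s s' : S) :
  exists phi : {linear unif_fun R s E -> unif_fun R s' E},
    bijective phi /\
    forall f : (X -> S) -> R, local_fun f ->
      exists2 u : unif_fun R s E,
        unif_val u = to_fin_config s f &
        unif_val (phi u) =
          to_fin_config s' (fun eta => f eta + (f (cst s) - f (cst s'))).
Proof.
have decE (t : S) (u : unif_fun R t E) : exists2 r : R, 0 < r & decoupled E r (unif_val u).
  by apply: uniform_decoupled; apply/asboolP; exact: (valP u).
have transportE (t t' : S) : exists F : unif_fun R t E -> unif_fun R t' E,
    forall u, transports (unif_val u) (unif_val (F u)).
  suff /choice[F FP] : forall u : unif_fun R t E, exists v : unif_fun R t' E,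
    transports (unif_val u) (unif_val v) by exists F.
  move=> u; have [r r_gt0 dec] := decE _ u.
  have [h uh] := decoupled_transports t' lfE dec.
  have hU : h \in uniform_pred E.
    by apply/asboolP/(decoupled_uniform r_gt0)/(transports_decoupled uh).
  by exists (UnifFun hU).
have [phi phiP] := transportE s s'; have [psi psiP] := transportE s' s.
have phi_lin : linear phi.
  move=> c u v; apply/val_inj; apply: transports_unique (phiP _) _.
  exact: transports_linear (phiP u) (phiP v).
pose phiL := HB.pack_for {linear unif_fun R s E -> unif_fun R s' E} phi
  (GRing.isLinear.Build _ _ _ _ phi phi_lin).
exists phiL; split.
  exists psi => u; have [r _ dec] := decE _ u; apply/val_inj.
    exact: transports_unique (psiP _) (transports_sym lfE dec (phiP u)).
  exact: transports_unique (phiP _) (transports_sym lfE dec (psiP u)).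
move=> f locf; have [r r_gt0 dec] := local_decoupled s connE locf.
have fU : to_fin_config s f \in uniform_pred E.
  by apply/asboolP; exact: decoupled_uniform dec.
exists (UnifFun fU) => //; apply: transports_unique (phiP _) _.
exact: local_transports.
Qed.
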